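(* Let $A_1,\dots,A_m\in\mathbb{C}^{n\times n}$ be Hermitian matrices, let $h_1,\dots,h_m:\mathbb{R}\to\mathbb{R}$ be differentiable and non-decreasing, and let $\phi_i$ be an anti-derivative of $h_i$ ($\phi_i'=h_i$) for $i=1,\dots,m$. Put $H(x)=\sum_{i=1}^m h_i(x^HA_ix)\,A_i$ and $F(x)=\sum_{i=1}^m\phi_i(x^HA_ix)$ for $x\in\mathbb{C}^n$. Let $\{x_k\}_{k\ge0}$ be a sequence of unit vectors generated by the SCF iteration for the mNEPv $H(x)x=\lambda x$. Then: (a) $F(x_{k+1})\ge F(x_k)$ for $k=0,1,\dots$, with equality only if $x_k$ is an eigenvector of the mNEPv. (b) Each (entry-wise) limit point $x_*$ of $\{x_k\}$ must be an eigenvector of the mNEPv, and it holds that $F(x_* )\ge F(x_k)$ for all $k\ge0$.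
   Context: A unit vector $x\in\mathbb{C}^n$ is an eigenvector of the mNEPv if $H(x)x=\lambda x$ for some $\lambda\in\mathbb{R}$ and, moreover, $\lambda$ $(=x^HH(x)x)$ is the largest eigenvalue of the Hermitian matrix $H(x)$. SCF iteration: starting from a unit vector $x_0\in\mathbb{C}^n$, for $k=0,1,2,\dots$ let $\lambda_{k+1}$ be the largest eigenvalue of $H(x_k)$ and let $x_{k+1}$ be any corresponding unit eigenvector, i.e. $H(x_k)x_{k+1}=\lambda_{k+1}x_{k+1}$, $\|x_{k+1}\|=1$. A vector $x_*$ is an (entry-wise) limit point of $\{x_k\}$ if $x_*=\lim_{j\to\infty}x_{k_j}$ for some subsequence $\{x_{k_j}\}$ with $k_1<k_2<\cdots$. *)

(* Defs.v *)
From HB Require Import structures.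
From mathcomp Require Import all_boot all_order all_algebra.
From mathcomp Require Import all_classical all_reals all_analysis.
From mathcomp Require Import complex.

Set Implicit Arguments.
Unset Strict Implicit.
Unset Printing Implicit Defensive.

Import Order.TTheory GRing.Theory Num.Theory.
Import numFieldNormedType.Exports.

Local Open Scope ring_scope.
Local Open Scope classical_set_scope.
Local Open Scope complex_scope.
Local Open Scope sesquilinear_scope.

Section mNEPv.
Variables (R : realType) (n : nat).

Definition norm2 (x : 'cV[R[i]]_n) : R :=
  Num.sqrt (\sum_i Normc.normc (x i 0) ^+ 2).

(* x^H A x, read as a real number; for A Hermitian the imaginary part
   dropped by [complex.Re] is 0. *)
Definition hquad (A : 'M[R[i]]_n) (x : 'cV[R[i]]_n) : R :=
  complex.Re ((x ^t* *m A *m x) 0 0).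

(* The eigenvalues of a Hermitian matrix are real, so comparing with the real
   ones is enough. The library's [eigenvalue] asks for a row (left) eigenvector;
   the resulting set of eigenvalues is the usual one. *)
Definition largest_eigenvalue (M : 'M[R[i]]_n) (lambda : R) : Prop :=
  eigenvalue M lambda%:C /\
  forall mu : R, eigenvalue M mu%:C -> mu <= lambda.

Section problem.
Variables (m : nat) (A : 'I_m -> 'M[R[i]]_n).

Definition Hmat (h : 'I_m -> R -> R) (x : 'cV[R[i]]_n) : 'M[R[i]]_n :=
  \sum_(i < m) (h i (hquad (A i) x))%:C *: A i.

Definition Fobj (phi : 'I_m -> R -> R) (x : 'cV[R[i]]_n) : R :=
  \sum_(i < m) phi i (hquad (A i) x).

Definition mNEPv_eigenvector (h : 'I_m -> R -> R) (x : 'cV[R[i]]_n) : Prop :=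
  norm2 x = 1 /\
  exists lambda : R,
    Hmat h x *m x = lambda%:C *: x /\ largest_eigenvalue (Hmat h x) lambda.

Definition SCF_sequence (h : 'I_m -> R -> R) (x : nat -> 'cV[R[i]]_n) : Prop :=
  norm2 (x 0%N) = 1 /\
  forall k : nat, exists lambda : R,
    [/\ largest_eigenvalue (Hmat h (x k)) lambda,
        Hmat h (x k) *m x k.+1 = lambda%:C *: x k.+1 &
        norm2 (x k.+1) = 1].

End problem.

(* [R[i]^o] is [R[i]] with the topology given by the complex modulus. *)
Definition entrywise_limit_point (x : nat -> 'cV[R[i]]_n) (xs : 'cV[R[i]]_n) : Prop :=
  exists s : nat -> nat,
    {homo s : j k / (j < k)%N} /\
    forall i : 'I_n, (fun j => x (s j) i 0 : R[i]^o) @ \oo --> (xs i 0 : R[i]^o).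

End mNEPv.

(* Main.v *)
Require Import Defs.
From HB Require Import structures.
From mathcomp Require Import all_boot all_order all_algebra.
From mathcomp Require Import all_classical all_reals all_analysis.
From mathcomp Require Import complex.
From mathcomp Require Import ring lra.

Set Implicit Arguments.
Unset Strict Implicit.
Unset Printing Implicit Defensive.

Import Order.TTheory GRing.Theory Num.Theory.
Import numFieldNormedType.Exports.

Local Open Scope ring_scope.
Local Open Scope classical_set_scope.
Local Open Scope complex_scope.
Local Open Scope sesquilinear_scope.

(** Each [phi i] has the non-decreasing derivative [h i], hence lies above its
    tangents: [phi i t - phi i s >= h i s * (t - s)].  Summing this at
    [s = u^H A_i u], [t = v^H A_i v] gives
      [F v - F u >= v^H H(u) v - u^H H(u) u]        ([Fobj_tangent_le]).
    For [u = x_k] and [v = x_(k+1)], [v^H H(u) v] is the largest eigenvalue of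
    [H(x_k)], which bounds the Rayleigh quotients of [H(x_k)] by the spectral
    theorem ([rayleigh_le]).  Hence, for every vector [y],
      [y^H H(x_k) y <= (x_k^H H(x_k) x_k + (F x_(k+1) - F x_k)) * |y|^2]
    ([SCF_gain_ge]), and the whole theorem follows from this inequality.

    Taking [y = x_k] gives [F x_k <= F x_(k+1)].  In case of equality it says
    that [x_k] maximizes the Rayleigh quotient of [H(x_k)]; a maximizer is an
    eigenvector for the largest eigenvalue ([rayleigh_max_largest]), because a
    positive semidefinite Hermitian form vanishes only on the kernel of its
    matrix ([psd_hquad_eq0]).

    If [x_(s j)] tends to [xs], then [F x_(s j)] tends to [F xs] by continuity,
    and [F xs >= F x_k] for all [k] by monotonicity.  In particular
    [F x_(s j + 1) - F x_(s j) <= F xs - F x_(s j)], which tends to 0, so the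
    inequality above passes to the limit along [s] and reads
    [y^H H(xs) y <= xs^H H(xs) xs * |y|^2]: again [xs] is a maximizer of the
    Rayleigh quotient of [H(xs)].  No limit of the sequence [x_(s j + 1)] is
    needed. *)

(** * Real parts, conjugate transposes and a real quadratic *)

Lemma Re_realM (R : realType) (a : R) (z : R[i]) :
  complex.Re (a%:C * z) = a * complex.Re z.
Proof. by case: z => u v /=; rewrite mul0r subr0. Qed.

Lemma ReD (R : realType) (y z : R[i]) :
  complex.Re (y + z) = complex.Re y + complex.Re z.
Proof. by case: y z => [a b] [c d]. Qed.

Lemma Re_conj (R : realType) (z : R[i]) : complex.Re (Num.conj z) = complex.Re z.
Proof. by case: z. Qed.

Lemma Re_mul_conj (R : realType) (z : R[i]) :
  complex.Re (Num.conj z * z) = Normc.normc z ^+ 2.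
Proof.
case: z => a b /=; rewrite sqr_sqrtr ?addr_ge0 ?sqr_ge0//.
by rewrite mulNr opprK -!expr2.
Qed.

Lemma conjC_real_complex (R : realType) (a : R) : Num.conj (a%:C) = a%:C :> R[i].
Proof. exact: conjc_real. Qed.

Lemma trmxCD (R : realType) m n (B C : 'M[R[i]]_(m, n)) :
  (B + C) ^t* = B ^t* + C ^t*.
Proof. by rewrite linearD /= map_mxD. Qed.

Lemma trmxCZ (R : realType) m n (a : R) (B : 'M[R[i]]_(m, n)) :
  (a%:C *: B) ^t* = a%:C *: B ^t*.
Proof. by rewrite linearZ /= map_mxZ /= conjC_real_complex. Qed.

Lemma quad_ge0_linear_eq0 (R : realFieldType) (a b : R) :
  (forall t, 0 <= 2 * t * a + t ^+ 2 * b) -> a = 0.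
Proof.
move=> h; have b0 : 0 <= b.
  by have := h 1; have := h (-1); rewrite sqrrN expr1n; lra.
have b1 : b + 1 != 0 by rewrite gt_eqF// ltr_wpDl.
(* The minimum is at [- a / b]; the denominator [b + 1] also covers [b = 0]. *)
have := h (- (a / (b + 1))).
have -> : 2 * - (a / (b + 1)) * a + (- (a / (b + 1))) ^+ 2 * b =
    - ((a / (b + 1)) ^+ 2 * (b + 2)) by field.
rewrite oppr_ge0 pmulr_lle0; last lra.
move=> a2; have : (a / (b + 1)) ^+ 2 == 0 by rewrite eq_le a2 sqr_ge0.
by rewrite sqrf_eq0 mulf_eq0 invr_eq0 (negPf b1) orbF => /eqP.
Qed.

(** * Hermitian quadratic forms and Rayleigh quotients *)

Section quadratic_forms.
Variables (R : realType) (n : nat).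
Implicit Types (M N : 'M[R[i]]_n) (x y z r : 'cV[R[i]]_n).

Lemma hquad0 x : hquad 0 x = 0.
Proof. by rewrite /hquad mulmx0 mul0mx mxE. Qed.

Lemma hquadD M N x : hquad (M + N) x = hquad M x + hquad N x.
Proof. by rewrite /hquad mulmxDr mulmxDl mxE ReD. Qed.

Lemma hquadZ (a : R) M x : hquad (a%:C *: M) x = a * hquad M x.
Proof. by rewrite /hquad -scalemxAr -scalemxAl mxE Re_realM. Qed.

Lemma hquad1 x : hquad 1%:M x = norm2 x ^+ 2.
Proof.
rewrite /hquad /norm2 mulmx1 sqr_sqrtr; last first.
  by apply: sumr_ge0 => i _; rewrite sqr_ge0.
rewrite mxE (big_morph _ (@ReD R) (erefl : complex.Re (0 : R[i]) = 0)).
apply: eq_bigr => i _; rewrite !mxE.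
exact: Re_mul_conj.
Qed.

Lemma hermsymmxP M : reflect (M ^t* = M) (M \is hermsymmx).
Proof.
apply: (iffP (is_hermitianmxP _ _ _)); rewrite expr0 scale1r; exact: esym.
Qed.

Lemma herm1 : (1%:M : 'M[R[i]]_n) \is hermsymmx.
Proof. by apply/hermsymmxP; rewrite trmx1 map_mx1. Qed.

Lemma hermD M N : M \is hermsymmx -> N \is hermsymmx -> M + N \is hermsymmx.
Proof.
move=> /hermsymmxP hM /hermsymmxP hN; apply/hermsymmxP.
by rewrite trmxCD hM hN.
Qed.

Lemma hermZ (a : R) M : M \is hermsymmx -> a%:C *: M \is hermsymmx.
Proof.
move=> /hermsymmxP hM; apply/hermsymmxP.
by rewrite trmxCZ hM.
Qed.

(** The real part of [y^H M x], of which [hquad] is the diagonal. *)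
Definition sesq M y x : R := complex.Re ((y ^t* *m M *m x) 0 0).

Lemma sesqDl M x y z : sesq M (x + y) z = sesq M x z + sesq M y z.
Proof. by rewrite /sesq trmxCD mulmxDl mulmxDl mxE ReD. Qed.

Lemma sesqDr M x y z : sesq M z (x + y) = sesq M z x + sesq M z y.
Proof. by rewrite /sesq mulmxDr mxE ReD. Qed.

Lemma sesqZl M (a : R) x z : sesq M (a%:C *: x) z = a * sesq M x z.
Proof. by rewrite /sesq trmxCZ -scalemxAl -scalemxAl mxE Re_realM. Qed.

Lemma sesqZr M (a : R) x z : sesq M z (a%:C *: x) = a * sesq M z x.
Proof. by rewrite /sesq -scalemxAr mxE Re_realM. Qed.

Lemma sesqC M x y : M \is hermsymmx -> sesq M x y = sesq M y x.
Proof.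
move=> /hermsymmxP hM; rewrite /sesq.
have -> : x ^t* *m M *m y = (y ^t* *m M *m x) ^t*.
  by rewrite !trmx_mul !map_mxM /= hM trmxCK mulmxA.
by rewrite mxE mxE Re_conj.
Qed.

Lemma hquad_line M x r (t : R) : M \is hermsymmx ->
  hquad M (x + t%:C *: r) =
  hquad M x + 2 * t * sesq M r x + t ^+ 2 * hquad M r.
Proof.
move=> hM; rewrite -[LHS]/(sesq M _ _).
rewrite sesqDl !sesqDr !sesqZl !sesqZr (sesqC x r hM).
rewrite -[hquad M x]/(sesq M x x) -[hquad M r]/(sesq M r r).
move: (sesq M x x) (sesq M r x) (sesq M r r) => p q s; ring.
Qed.

(** At a zero [x] of a nonnegative form, the derivative in every direction
    vanishes; in the direction [M x] this derivative is twice [|M x|^2]. *)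
Lemma psd_hquad_eq0 M x : M \is hermsymmx -> (forall y, 0 <= hquad M y) ->
  hquad M x = 0 -> M *m x = 0.
Proof.
move=> hM Mge0 Mx0; set r := M *m x.
have : sesq M r x = 0.
  apply: (@quad_ge0_linear_eq0 _ _ (hquad M r)) => t.
  by rewrite -[X in 0 <= X]add0r -[X in X + _]Mx0 addrA -hquad_line.
have -> : sesq M r x = hquad 1%:M r.
  by rewrite /hquad mulmx1 /sesq -mulmxA.
rewrite hquad1 /norm2 sqr_sqrtr; last first.
  by apply: sumr_ge0 => i _; exact: sqr_ge0.
move/psumr_eq0P => r0; apply/matrixP => i j; rewrite (ord1 j) [RHS]mxE.
apply: Normc.eq0_normc; apply/eqP; rewrite -sqrf_eq0; apply/eqP/r0 => // k _.
exact: sqr_ge0.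
Qed.

(** [eigenvalue] refers to row eigenvectors; for a Hermitian matrix and a real
    value, conjugate transposition turns these into column eigenvectors. *)
Lemma eigenvalue_right M (a : R) : M \is hermsymmx ->
  reflect (exists2 v : 'cV[R[i]]_n, M *m v = a%:C *: v & v != 0)
    (eigenvalue M a%:C).
Proof.
move=> /hermsymmxP hM; apply: (iffP eigenvalueP) => -[v vM v0].
  exists (v ^t*).
    by rewrite -[in LHS]hM -map_mxM -trmx_mul vM trmxCZ.
  by apply: contra_neq v0 => v0; rewrite -[v]trmxCK v0 trmx0 map_mx0.
exists (v ^t*).
  by rewrite -[in LHS]hM -map_mxM -trmx_mul vM trmxCZ.
by apply: contra_neq v0 => v0; rewrite -[v]trmxCK v0 trmx0 map_mx0.
Qed.

(** In the coordinates [z = P y] of a unitary diagonalization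
    [M = P^H diag(d) P], the form is [\sum_i d_i |z_i|^2] with every [d_i] a
    real eigenvalue of [M]. *)
Lemma rayleigh_le M (a : R) y : M \is hermsymmx -> largest_eigenvalue M a ->
  hquad M y <= a * norm2 y ^+ 2.
Proof.
move=> hM [_ amax].
set P := spectralmx M; set d := spectral_diag M.
have PU : P \is unitarymx := spectral_unitarymx M.
have PK : P *m P ^t* = 1%:M by apply/unitarymxP.
have KP : P ^t* *m P = 1%:M by apply: mulmx1C.
have ME : M = P ^t* *m diag_mx d *m P.
  by rewrite -invmx_unitary//; apply/orthomx_spectralP/hermitian_normalmx.
have dR i : d 0 i = (complex.Re (d 0 i))%:C.
  by rewrite RRe_real//; have /mxOverP := hermitian_spectral_diag_real hM; apply.
(* Row [i] of [P] is a row eigenvector of [M] for [d_i]. *)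
have dle i : complex.Re (d 0 i) <= a.
  apply: amax; apply/eigenvalueP; exists (row i P).
    rewrite -dR {1}ME !mulmxA -row_mul PK row1 -rowE.
    by rewrite row_diag_mx -scalemxAl -rowE.
  apply/negP => /eqP Pi0.
  have /matrixP/(_ 0 i) : row i (P *m P ^t*) = 0 by rewrite row_mul Pi0 mul0mx.
  by rewrite PK !mxE eqxx => /eqP; rewrite oner_eq0.
set z := P *m y.
have zE D : hquad (P ^t* *m D *m P) y = hquad D z.
  by rewrite /hquad /z !trmx_mul !map_mxM /= !mulmxA.
have -> : norm2 y = norm2 z.
  have : norm2 y ^+ 2 = norm2 z ^+ 2.
    by rewrite -!hquad1 -zE mulmx1 KP.
  by move/eqP; rewrite eqrXn2 ?sqrtr_ge0// => /eqP.
rewrite {1}ME zE; clearbody z; rewrite /hquad mul_mx_diag mxE.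
rewrite (big_morph _ (@ReD R) (erefl : complex.Re (0 : R[i]) = 0)).
rewrite /norm2 sqr_sqrtr; last by apply: sumr_ge0 => i _; rewrite sqr_ge0.
rewrite mulr_sumr; apply: ler_sum => i _; rewrite !mxE dR.
rewrite mulrAC mulrC Re_realM.
apply: le_trans (ler_wpM2r (sqr_ge0 _) (dle i)).
by rewrite -Re_mul_conj mulrC.
Qed.

Lemma hquad_eigen M (a : R) v :
  M *m v = a%:C *: v -> hquad M v = a * norm2 v ^+ 2.
Proof.
by move=> Mv; rewrite -hquad1 -hquadZ /hquad -!mulmxA Mv scalemx1 mul_scalar_mx.
Qed.

Lemma norm2_ge0 x : 0 <= norm2 x. Proof. exact: sqrtr_ge0. Qed.

Lemma norm2_gt0 x : x != 0 -> 0 < norm2 x.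
Proof.
apply: contra_neqT; rewrite lt_neqAle norm2_ge0 andbT negbK eq_sym => /eqP x0.
rewrite -[x]mul1mx; apply: psd_hquad_eq0 => [|y|].
- exact: herm1.
- by rewrite hquad1 sqr_ge0.
- by rewrite hquad1 x0 expr0n.
Qed.

(** A unit maximizer of the Rayleigh quotient is an eigenvector for the largest
    eigenvalue: apply [psd_hquad_eq0] to [N = a I - M], where [a] is the
    maximum. *)
Lemma rayleigh_max_largest M x : M \is hermsymmx -> norm2 x = 1 ->
  (forall y, hquad M y <= hquad M x * norm2 y ^+ 2) ->
  M *m x = (hquad M x)%:C *: x /\ largest_eigenvalue M (hquad M x).
Proof.
move=> hM x1 xmax; set a := hquad M x.
pose N := a%:C *: 1%:M + (-1)%:C *: M.
have NE y : hquad N y = a * norm2 y ^+ 2 - hquad M y.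
  by rewrite hquadD !hquadZ hquad1 mulN1r.
have Nx : N *m x = 0.
  apply: psd_hquad_eq0.
  - by apply: hermD; apply: hermZ; [exact: herm1|exact: hM].
  - by move=> y; rewrite NE subr_ge0.
  - by rewrite NE x1 expr1n mulr1 subrr.
have Mx : M *m x = a%:C *: x.
  move: Nx; rewrite mulmxDl -!scalemxAl mul1mx rmorphN rmorph1 scaleN1r.
  by move/eqP; rewrite subr_eq0 => /eqP.
split=> //; split.
  apply/(eigenvalue_right _ hM); exists x => //; apply/eqP => x0.
  move: (hquad1 x); rewrite x1 x0 /hquad mulmx0 mxE expr1n => /eqP.
  by rewrite eq_sym oner_eq0.
move=> b /(eigenvalue_right _ hM) [v /hquad_eigen vb v0].
by have := xmax v; rewrite vb ler_pM2r// exprn_gt0// norm2_gt0.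
Qed.

End quadratic_forms.

(** * Antiderivatives of non-decreasing functions *)

Section convexity.
Variable R : realType.

Lemma antiderivative_tangent_le (f g : R -> R) (s t : R) :
  {homo g : u v / u <= v} -> (forall u : R, is_derive u 1 f (g u)) ->
  g s * (t - s) <= f t - f s.
Proof.
move=> gmono fg.
have fc (a b : R) : {within `[a, b], continuous f}.
  apply: derivable_within_continuous => u _.
  exact: (@ex_derive _ _ _ _ _ _ _ (fg u)).
have [st|ts|->] := ltgtP s t; last by rewrite !subrr mulr0.
  have [c /andP[sc _] ->] := MVT st (fun u _ => fg u) (fc s t).
  by rewrite ler_pM2r ?subr_gt0// gmono// ltW.
have [c /andP[_ cs] E] := MVT ts (fun u _ => fg u) (fc t s).
rewrite -(opprB s t) mulrN -(opprB (f s)) E lerN2.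
by rewrite ler_pM2r ?subr_gt0// gmono// ltW.
Qed.

Lemma derivable_continuous (f : R -> R) :
  (forall t : R, derivable f t 1) -> continuous f.
Proof. by move=> df t; exact/differentiable_continuous/derivable1_diffP. Qed.

End convexity.

(** * Entry-wise limits *)

Section limits.
Variables (R : realType) (n : nat).

Lemma cvg_conj (u : nat -> R[i]^o) (l : R[i]^o) : u @ \oo --> l ->
  (fun k => Num.conj (u k : R[i]) : R[i]^o) @ \oo -->
    (Num.conj (l : R[i]) : R[i]^o).
Proof.
move=> /cvgrPdist_lt ul; apply/cvgrPdist_lt => e e0.
near=> k; rewrite -rmorphB norm_conjC; near: k; exact: ul.
Unshelve. all: by end_near. Qed.

Lemma cvg_Re (u : nat -> R[i]^o) (l : R[i]^o) : u @ \oo --> l ->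
  (fun k => complex.Re (u k)) @ \oo --> complex.Re l.
Proof.
move=> /cvgrPdist_lt ul; apply/cvgrPdist_lt => e e0.
have e0' : (0 : R[i]) < e%:C by rewrite ltcR.
near=> k; have : `|(l : R[i]) - u k| < e%:C by near: k; exact: ul.
case: (l) (u k) => [a b] [c d]; rewrite normc_def /= ltcR; apply: le_lt_trans.
by rewrite -sqrtr_sqr ler_wsqrtr// lerDl sqr_ge0.
Unshelve. all: by end_near. Qed.

(** Convergence of all entries in the complex plane, as in
    [entrywise_limit_point] but along the whole sequence. *)
Definition entrywise_cvg (u : nat -> 'cV[R[i]]_n) (l : 'cV[R[i]]_n) : Prop :=
  forall i : 'I_n, (fun k => u k i 0 : R[i]^o) @ \oo --> (l i 0 : R[i]^o).

Lemma entrywise_cvg_cst (y : 'cV[R[i]]_n) : entrywise_cvg (fun=> y) y.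
Proof. by move=> i; exact: cvg_cst. Qed.

Lemma cvg_hquad (M : 'M[R[i]]_n) (u : nat -> 'cV[R[i]]_n) (l : 'cV[R[i]]_n) :
  entrywise_cvg u l -> (fun k => hquad M (u k)) @ \oo --> hquad M l.
Proof.
move=> ul; apply: cvg_Re.
have E (v : 'cV[R[i]]_n) : (v ^t* *m M *m v) 0 0 =
    \sum_j (\sum_i (Num.conj (v i 0) : R[i]^o) * (M i j : R[i]^o)) *
      (v j 0 : R[i]^o) :> R[i]^o.
  rewrite mxE; apply: eq_bigr => j _; rewrite mxE; congr (_ * _).
  by apply: eq_bigr => i _; rewrite !mxE.
rewrite E; under eq_fun do rewrite E.
apply: cvg_big => [|j _]; first exact: add_continuous.
apply: cvgM; last exact: ul.
apply: cvg_big => [|i _]; first exact: add_continuous.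
apply: cvgM; last exact: cvg_cst.
exact: cvg_conj.
Qed.

End limits.

(** * The SCF iteration *)

Section scf.
Variables (R : realType) (n m : nat) (A : 'I_m -> 'M[R[i]]_n).
Variables (h phi : 'I_m -> R -> R).
Hypothesis A_herm : forall i, A i \is hermsymmx.
Hypothesis h_mono : forall i, {homo h i : s t / s <= t}.
Hypothesis phi_h : forall i (t : R), is_derive t 1 (phi i) (h i t).

Lemma hquad_Hmat u v :
  hquad (Hmat A h u) v = \sum_i h i (hquad (A i) u) * hquad (A i) v.
Proof.
rewrite /Hmat.
rewrite (big_morph (fun M => hquad M v) (fun M N => hquadD M N v) (hquad0 v)).
by apply: eq_bigr => i _; rewrite hquadZ.
Qed.

Lemma Hmat_herm u : Hmat A h u \is hermsymmx.
Proof.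
apply: (big_ind (fun M : 'M[R[i]]_n => M \is hermsymmx)) => [|M N|i _].
- by apply/hermsymmxP; rewrite trmx0 map_mx0.
- exact: hermD.
- exact/hermZ/A_herm.
Qed.

(** The tangent inequality for [F]; [H u] plays the role of its gradient in the
    variables [u^H A_i u]. *)
Lemma Fobj_tangent_le u v :
  hquad (Hmat A h u) v - hquad (Hmat A h u) u <= Fobj A phi v - Fobj A phi u.
Proof.
rewrite !hquad_Hmat /Fobj -!sumrB; apply: ler_sum => i _.
by rewrite -mulrBr; exact: antiderivative_tangent_le.
Qed.

(** One SCF step bounds the defect of [x k] from maximizing the Rayleigh
    quotient of [H (x k)] by the increase of [F]. *)
Lemma SCF_gain_ge (x : nat -> 'cV[R[i]]_n) k y : SCF_sequence A h x ->
  hquad (Hmat A h (x k)) y <=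
  (hquad (Hmat A h (x k)) (x k) + (Fobj A phi (x k.+1) - Fobj A phi (x k))) *
  norm2 y ^+ 2.
Proof.
move=> [_ /(_ k) [a [amax xa x1]]].
apply: (le_trans (rayleigh_le y (Hmat_herm _) amax)).
rewrite ler_wpM2r ?sqr_ge0//.
have <- : hquad (Hmat A h (x k)) (x k.+1) = a.
  by rewrite (hquad_eigen xa) x1 expr1n mulr1.
by rewrite -lerBlDl Fobj_tangent_le.
Qed.

Lemma SCF_unit (x : nat -> 'cV[R[i]]_n) k : SCF_sequence A h x -> norm2 (x k) = 1.
Proof. by case: k => [|k] [x0 xS]; [|case: (xS k) => a []]. Qed.

Lemma SCF_Fobj_le (x : nat -> 'cV[R[i]]_n) k : SCF_sequence A h x ->
  Fobj A phi (x k) <= Fobj A phi (x k.+1).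
Proof.
move=> xS; have := SCF_gain_ge k (x k) xS.
by rewrite (SCF_unit k xS) expr1n mulr1 lerDl subr_ge0.
Qed.

Lemma mNEPv_eigenvector_rayleigh u : norm2 u = 1 ->
  (forall y, hquad (Hmat A h u) y <= hquad (Hmat A h u) u * norm2 y ^+ 2) ->
  mNEPv_eigenvector A h u.
Proof.
move=> u1 umax; split=> //; exists (hquad (Hmat A h u) u).
exact: rayleigh_max_largest (Hmat_herm u) u1 umax.
Qed.

Lemma cvg_hquad_Hmat (u v : nat -> 'cV[R[i]]_n) (l y : 'cV[R[i]]_n) :
  (forall i, continuous (h i)) -> entrywise_cvg u l -> entrywise_cvg v y ->
  (fun j => hquad (Hmat A h (u j)) (v j)) @ \oo --> hquad (Hmat A h l) y.
Proof.
move=> hc ul vy; rewrite hquad_Hmat; under eq_fun do rewrite hquad_Hmat.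
apply: cvg_big => [|i _]; first exact: add_continuous.
apply: cvgM; last exact: cvg_hquad.
exact: cvg_comp (cvg_hquad ul) (hc i _).
Qed.

Lemma cvg_Fobj (u : nat -> 'cV[R[i]]_n) (l : 'cV[R[i]]_n) :
  entrywise_cvg u l ->
  (fun j => Fobj A phi (u j)) @ \oo --> Fobj A phi l.
Proof.
move=> ul; rewrite /Fobj.
apply: cvg_big => [|i _]; first exact: add_continuous.
have phic : continuous (phi i).
  apply: derivable_continuous => t.
  exact: (@ex_derive _ _ _ _ _ _ _ (phi_h i t)).
exact: cvg_comp (cvg_hquad ul) (phic _).
Qed.

End scf.

Theorem theorem3p2 (R : realType) (n m : nat) (A : 'I_m -> 'M[R[i]]_n)
    (h phi : 'I_m -> R -> R) (x : nat -> 'cV[R[i]]_n)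
    (A_herm : forall i : 'I_m, A i \is hermsymmx)
    (h_diff : forall (i : 'I_m) (t : R), derivable (h i) t 1)
    (h_mono : forall i : 'I_m, {homo h i : s t / s <= t})
    (phi_h : forall (i : 'I_m) (t : R), is_derive t 1 (phi i) (h i t))
    (x_SCF : SCF_sequence A h x) :
  (forall k : nat,
     Fobj A phi (x k) <= Fobj A phi (x k.+1) /\
     (Fobj A phi (x k.+1) = Fobj A phi (x k) -> mNEPv_eigenvector A h (x k)))
  /\
  (forall xs : 'cV[R[i]]_n, entrywise_limit_point x xs ->
     mNEPv_eigenvector A h xs /\
     forall k : nat, Fobj A phi (x k) <= Fobj A phi xs).
Proof.
split=> [k|xs [s [s_incr lim_xs]]].
  split=> [|Fk]; first exact: SCF_Fobj_le.
  apply: mNEPv_eigenvector_rayleigh => [//||y]; first exact: SCF_unit x_SCF.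
  have := SCF_gain_ge A_herm h_mono phi_h k y x_SCF.
  by rewrite Fk subrr addr0.
have hc i : continuous (h i).
  by apply: derivable_continuous => t; exact: h_diff.
have F_incr : {homo (fun k => Fobj A phi (x k)) : j k / (j <= k)%N >-> j <= k}.
  apply: homo_leq => [//|v u w|k]; [exact: le_trans|exact: SCF_Fobj_le].
have s_ge j : (j <= s j)%N.
  elim: j => // j IH; exact: leq_ltn_trans IH (s_incr _ _ (ltnSn j)).
have xs_lim : entrywise_cvg (fun j => x (s j)) xs := lim_xs.
have F_lim : (fun j => Fobj A phi (x (s j))) @ \oo --> Fobj A phi xs.
  exact: (cvg_Fobj phi_h xs_lim).
have F_le k : Fobj A phi (x k) <= Fobj A phi xs.
  apply: (cvgr_to_ge F_lim).
  near=> j; apply: F_incr; apply: leq_trans (s_ge j).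
  by near: j; exact: nbhs_infty_ge.
split=> //; have xs1 : norm2 xs = 1.
  have : (fun j => hquad 1%:M (x (s j))) @ \oo --> hquad 1%:M xs.
    exact: cvg_hquad.
  under eq_fun do rewrite hquad1 (SCF_unit _ x_SCF) expr1n.
  move=> /(cvg_lim (@norm_hausdorff _ _)); rewrite lim_cst// => /esym/eqP.
  rewrite hquad1 sqrf_eq1 => /orP[/eqP//|/eqP x1].
  by have := norm2_ge0 xs; rewrite x1; lra.
apply: mNEPv_eigenvector_rayleigh => // y.
have lhs_lim : (fun j => hquad (Hmat A h (x (s j))) y) @ \oo -->
    hquad (Hmat A h xs) y.
  exact: (cvg_hquad_Hmat hc xs_lim (@entrywise_cvg_cst _ _ y)).
(* [F xs] stands in for [F (x (s j).+1)], so that only limits along [s] occur. *)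
have rhs_lim : (fun j => (hquad (Hmat A h (x (s j))) (x (s j)) +
      (Fobj A phi xs - Fobj A phi (x (s j)))) * norm2 y ^+ 2) @ \oo -->
    (hquad (Hmat A h xs) xs + (Fobj A phi xs - Fobj A phi xs)) * norm2 y ^+ 2.
  apply: cvgM; last exact: cvg_cst.
  apply: cvgD; first exact: (cvg_hquad_Hmat hc xs_lim xs_lim).
  by apply: cvgB; [exact: cvg_cst|exact: F_lim].
rewrite subrr addr0 in rhs_lim.
apply: (ler_cvg_to lhs_lim rhs_lim).
near=> j; apply: (le_trans (SCF_gain_ge A_herm h_mono phi_h (s j) y x_SCF)).
by rewrite ler_wpM2r ?sqr_ge0// lerD2l lerD2r.
Unshelve. all: by end_near. Qed.
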